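(* A finite group $\Gamma$ is closed under polymatroid duality if and only if $\Gamma$ is abelian.
   Context: For a positive integer $n$ and a subgroup $\mathcal{H}\le\Gamma^n$, let $P(\mathcal{H})=([n],r_{\mathcal{H}})$ with $r_{\mathcal{H}}(S)=\log_{|\Gamma|}|\pi_S(\mathcal{H})|$, where $\pi_S:\Gamma^n\to\Gamma^S$ is the coordinate projection ($\pi_\emptyset(\mathcal H)$ trivial). Its dual is $P^*(\mathcal{H})=([n],r^*_{\mathcal{H}})$ with $r^*_{\mathcal{H}}(S)=r_{\mathcal{H}}([n]-S)+|S|-r_{\mathcal{H}}([n])$. $\Gamma$ is closed under polymatroid duality if for every $n$ and every subgroup $\mathcal{H}\le\Gamma^n$ there exists a subgroup $\mathcal{H}'\le\Gamma^n$ with $P^*(\mathcal{H})=P(\mathcal{H}')$. *)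

(* Defs.v *)
From HB Require Import structures.
From mathcomp Require Import all_boot all_order all_algebra all_fingroup.
From mathcomp Require Import reals exp.

Set Implicit Arguments.
Unset Strict Implicit.
Unset Printing Implicit Defensive.

Import Order.TTheory GRing.Theory Num.Theory.
Local Open Scope ring_scope.

(* The group Gamma is the whole of gT, the ground set [n] is 'I_n, and Gamma^n *)
(* is {dffun forall _ : 'I_n, gT} with the coordinatewise law of gproduct.     *)
(* It is not written {ffun 'I_n -> gT} because finGroupType structures are     *)
(* only inferred on dffun.                                                     *)

Definition logb (R : realType) (b x : R) : R := ln x / ln b.

Definition coord_proj (gT : finGroupType) (n : nat) (S : {set 'I_n})
    (h : {dffun forall _ : 'I_n, gT}) : {ffun {i : 'I_n | i \in S} -> gT} :=
  [ffun i => h (val i)].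

(* A polymatroid on 'I_n is represented by its rank function.                  *)
Definition group_polymatroid (R : realType) (gT : finGroupType) (n : nat)
    (H : {group {dffun forall _ : 'I_n, gT}}) : {ffun {set 'I_n} -> R} :=
  [ffun S : {set 'I_n} => logb #|[set: gT]|%:R #|coord_proj S @: H|%:R].

Definition dual_polymatroid (R : realType) (n : nat)
    (r : {ffun {set 'I_n} -> R}) : {ffun {set 'I_n} -> R} :=
  [ffun S : {set 'I_n} => r (~: S) + #|S|%:R - r [set: 'I_n]].

(* With #|[set: gT]| = 1 the rank function is a logarithm in base 1, here      *)
(* 0 / 0 = 0, so this is only meaningful for nontrivial gT.                    *)
Definition closed_under_polymatroid_duality (R : realType)
    (gT : finGroupType) : Prop :=
  forall n : nat, (0 < n)%N ->
  forall H : {group {dffun forall _ : 'I_n, gT}},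
  exists H' : {group {dffun forall _ : 'I_n, gT}},
    dual_polymatroid (group_polymatroid R H) = group_polymatroid R H'.

(* Main.v *)
(** Forward direction: apply duality to the diagonal of Gamma^3.  In the dual
    subgroup any two coordinates determine the third and can be chosen freely,
    so it contains u = (1, _, a) and v = (_, 1, b); their commutator is trivial
    in the first two coordinates, hence in the third, and a, b commute.

    Backward direction: an abelian Gamma carries a symmetric nondegenerate
    pairing with values in the roots of unity.  The coordinatewise product of
    this pairing makes Gamma^n self-dual, and H' is the annihilator of H. *)

Require Import Defs.
From mathcomp Require Import all_boot all_order all_algebra all_fingroup.
From mathcomp Require Import all_solvable all_field.
From mathcomp Require Import reals exp.

Set Implicit Arguments.
Unset Strict Implicit.
Unset Printing Implicit Defensive.

Import Order.TTheory GRing.Theory Num.Theory GroupScope.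

(** * Self-duality of finite abelian groups *)

(** Symmetry carries multiplicativity over to the second argument. Multiplicativity alone allows
    [B 1 z] to be 0 or 1, and the second clause excludes 0; on a group the values are then roots of
    unity. *)
Definition pairing (gT : finGroupType) (A : {set gT}) (B : gT -> gT -> algC) :=
  [/\ {in A &, commutative B},
      {in A, forall z, B 1 z = 1%R},
      {in A & &, forall x y z, B (x * y) z = (B x z * B y z)%R}
    & {in A, forall x, {in A, forall y, B x y = 1%R} -> x = 1}].

Definition annihilator (gT : finGroupType) (A : {set gT})
    (B : gT -> gT -> algC) (H : {set gT}) : {set gT} :=
  [set y in A | [forall h in H, B h y == 1%R]].

(** Orthogonality of characters: translating the summation variable by [a] multiplies the sum by
    [f a], which differs from 1. *)
Lemma sum_nontrivial_multiplicative (gT : finGroupType) (A : {group gT})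
    (f : gT -> algC) (a : gT) :
  {in A &, {morph f : x y / x * y >-> (x * y)%R}} ->
  a \in A -> f a != 1%R -> (\sum_(x in A) f x = 0)%R.
Proof.
move=> fM Aa fa1; set s := (\sum_(x in A) f x)%R.
have fas : (f a * s = s)%R.
  rewrite /s mulr_sumr [RHS](reindex_inj (mulgI a)) /=.
  by apply: eq_big => x; rewrite ?groupMl// => Ax; rewrite fM.
apply/eqP; have : ((f a - 1) * s == 0)%R by rewrite mulrBl mul1r fas subrr.
by rewrite mulf_eq0 subr_eq0 (negPf fa1).
Qed.

Section PairingTheory.

Variables (gT : finGroupType) (A : {group gT}) (B : gT -> gT -> algC).
Hypothesis pairB : pairing A B.

Lemma group_set_annihilator (H : {set gT}) :
  H \subset A -> group_set (annihilator A B H).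
Proof.
have [BC B1 BM _] := pairB => /subsetP sHA.
apply/group_setP; split=> [|x y].
  rewrite inE group1; apply/forall_inP => h /sHA Ah.
  by rewrite BC ?group1// B1.
rewrite !inE => /andP[Ax /forall_inP Bx] /andP[Ay /forall_inP By].
rewrite groupM//; apply/forall_inP => h Hh; have Ah := sHA h Hh.
rewrite BC ?groupM// BM// (BC x)// (BC y)//.
by rewrite (eqP (Bx h Hh)) (eqP (By h Hh)) mulr1.
Qed.

(* Double counting: sum [B h y] over [h] in [H] and [y] in [A]. *)
Lemma card_annihilator (H : {group gT}) :
  H \subset A -> (#|H| * #|annihilator A B H|)%N = #|A|.
Proof.
have [BC B1 BM Bnd] := pairB => /subsetP sHA.
apply/eqP; rewrite -(eqr_nat algC) natrM; apply/eqP.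
(* Summing over [y] first, only [h = 1] survives: by nondegeneracy every other [h] gives a
   nontrivial character of [A]. *)
have <- : (\sum_(h in H) \sum_(y in A) B h y = #|A|%:R)%R.
  rewrite (bigD1 1)//= [X in (_ + X)%R]big1 ?addr0.
    by rewrite (eq_bigr (fun=> 1%R)) ?sumr_const// => y /B1.
  move=> h /andP[Hh h1]; have Ah := sHA h Hh.
  have [y Ay Bhy] : exists2 y, y \in A & B h y != 1%R.
    apply/exists_inP; apply: contraR h1 => /exists_inPn Bh.
    by apply/eqP/Bnd => // y /Bh; rewrite negbK => /eqP.
  apply: (sum_nontrivial_multiplicative _ Ay Bhy) => x z Ax Az.
  by rewrite BC ?groupM// BM// !(BC h).
(* Summing over [h] first, each [y] in the annihilator contributes [#|H|] and every other [y]
   contributes 0. *)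
rewrite exchange_big /= (bigID (mem (annihilator A B H))) /=.
rewrite [X in (_ + X)%R]big1 ?addr0.
  transitivity (\sum_(y in annihilator A B H) #|H|%:R : algC)%R.
    by rewrite sumr_const mulr_natr.
  apply: eq_big => [y|y]; first by rewrite inE; case: (y \in A).
  rewrite inE => /andP[Ay /forall_inP By].
  by rewrite (eq_bigr (fun=> 1%R)) ?sumr_const// => h /By/eqP.
move=> y /andP[Ay]; rewrite inE Ay /= => /forall_inPn[h Hh Bhy].
apply: (sum_nontrivial_multiplicative _ Hh Bhy) => x z Hx Hz.
by rewrite BM// sHA.
Qed.

Lemma annihilatorM (H K : {group gT}) : H \subset A -> K \subset A ->
  annihilator A B (H * K) = annihilator A B H :&: annihilator A B K.
Proof.
have [_ _ BM _] := pairB => /subsetP sHA /subsetP sKA.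
apply/setP => y; rewrite !inE; case Ay: (y \in A) => //=.
apply/forall_inP/andP => [BHK|[/forall_inP BH /forall_inP BK] _ /mulsgP[h k Hh Kk ->]].
  split; apply/forall_inP => x xHK; apply: BHK.
    exact: (subsetP (mulG_subl _ _)).
  exact: (subsetP (mulG_subr _ _)).
have [Ah Ak] := (sHA h Hh, sKA k Kk).
by rewrite BM// (eqP (BH h Hh)) (eqP (BK k Kk)) mulr1.
Qed.

End PairingTheory.

(** With [z] a primitive root of unity of order [#[x]], the pairing sends [x ^+ i] and [x ^+ j] to
    [z ^+ (i * j)]. *)
Lemma pairing_cycle (gT : finGroupType) (x : gT) :
  exists B, pairing <[x]> B.
Proof.
have [z zP] := C_prim_root_exists (order_gt0 x).
pose dlog u : nat := if [pick i : 'I_#[x] | x ^+ i == u] is Some i then i else 0.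
have dlogK u : u \in <[x]> -> x ^+ dlog u = u.
  move=> /cyclePmin[i lti ->]; rewrite /dlog.
  by case: pickP => [j /eqP//|/(_ (Ordinal lti))]; rewrite eqxx.
have dlogP u k : u \in <[x]> -> (x ^+ k == u) = (k == dlog u %[mod #[x]]).
  by move=> ux; rewrite -{1}(dlogK u ux) eq_expg_mod_order.
(* Exponents of [z] matter only modulo [#[x]], so [dlog u] may be replaced by any [k] with
   [x ^+ k = u]. *)
have zdlog u k m : u \in <[x]> -> x ^+ k = u ->
    (z ^+ (dlog u * m) = z ^+ (k * m))%R.
  move=> ux /eqP; rewrite dlogP// => kE; rewrite !exprM; congr (_ ^+ _)%R.
  by apply/eqP; rewrite (eq_prim_root_expr zP) eq_sym.
exists (fun u v => z ^+ (dlog u * dlog v))%R; split=> [u v _ _|v _|u v w ux vx _|u ux].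
- by rewrite mulnC.
- by rewrite (zdlog _ 0%N)// mul0n expr0.
- rewrite (zdlog _ (dlog u + dlog v)%N) ?groupM//; last by rewrite expgD !dlogK.
  by rewrite mulnDl exprD.
(* Testing against the generator gives [z ^+ dlog u = 1], so [#[x]] divides [dlog u]. *)
- move/(_ x (cycle_id x)); rewrite mulnC (zdlog _ 1%N) ?cycle_id// mul1n => /eqP.
  by rewrite -(prim_order_dvd zP) order_dvdn dlogK// => /eqP.
Qed.

Lemma pairing_dprod (gT : finGroupType) (K H G : {group gT})
    (BK BH : gT -> gT -> algC) :
  K \x H = G -> pairing K BK -> pairing H BH -> exists B, pairing G B.
Proof.
case/dprodP=> _ defG cKH tiKH [KC K1 KM Knd] [HC H1 HM Hnd].
have compl : H \in [complements to K in G] by apply/complP.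
have divM := divgrM compl cKH.
have nKG : K <| G.
  by rewrite -defG -cent_joinEr// normalYl cents_norm.
have remM := remgrM compl nKG.
have Kd x : x \in G -> divgr K H x \in K by rewrite -defG; apply: mem_divgr.
have Hr x : x \in G -> remgr K H x \in H by rewrite -defG; apply: mem_remgr.
have sKG : K \subset G by rewrite -defG mulG_subl.
have sHG : H \subset G by rewrite -defG mulG_subr.
have d1 y : y \in H -> divgr K H y = 1.
  by move=> Hy; rewrite -[y]mul1g divgrMid.
have r1 x : x \in K -> remgr K H x = 1 by apply: remgr1.
exists (fun x y => BK (divgr K H x) (divgr K H y)
                   * BH (remgr K H x) (remgr K H y))%R.
split=> [x y Gx Gy|x Gx|x y z Gx Gy Gz|x Gx Bx].
- by congr (_ * _)%R; [apply: KC; apply: Kd | apply: HC; apply: Hr].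
- by rewrite (d1 1)// (r1 1)// K1 ?H1 ?Kd ?Hr// mulr1.
- by rewrite divM// remM// KM ?HM ?Kd ?Hr// mulrACA.
(* Elements of [K] have trivial [H]-component, so testing against them isolates the [K]-component of
   [x]; the other factor is symmetric. *)
- have dx1 : divgr K H x = 1.
    apply: Knd (Kd x Gx) _ => y yK.
    have := Bx y (subsetP sKG y yK); rewrite (r1 y)// (divgr_id H yK).
    by rewrite (HC _ 1) ?Hr// H1 ?Hr// mulr1.
  have rx1 : remgr K H x = 1.
    apply: Hnd (Hr x Gx) _ => y yH.
    have := Bx y (subsetP sHG y yH); rewrite (d1 y)// (remgr_id tiKH yH).
    by rewrite (KC _ 1) ?Kd// K1 ?Kd// mul1r.
  by rewrite (divgr_eq K H x) dx1 rx1 mulg1.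
Qed.

Lemma abelian_pairing (gT : finGroupType) (G : {group gT}) :
  abelian G -> exists B, pairing G B.
Proof.
case/abelian_structure=> b defG _; elim: b G defG => [|x b IHb] G.
  rewrite big_nil => <-; exists (fun _ _ => 1%R).
  by split=> // [x y z|x]; rewrite ?mulr1// inE => /eqP.
rewrite big_cons => defG; have [[_ H _ defH] _ _ _] := dprodP defG.
have [B2 pB2] := IHb H defH; have [B1 pB1] := pairing_cycle x.
by rewrite defH in defG; apply: pairing_dprod defG pB1 pB2.
Qed.

(** * Coordinate projections of subgroups of Gamma^n *)

Section Projections.

Variables (gT : finGroupType) (n : nat).
Local Notation gTn := {dffun forall _ : 'I_n, gT}.
Implicit Types (S : {set 'I_n}) (H : {group gTn}).

Definition trivial_on S : {set gTn} := [set x : gTn | [forall i in S, x i == 1]].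

Lemma trivial_onP S (x : gTn) :
  reflect {in S, forall i, x i = 1} (x \in trivial_on S).
Proof. by rewrite inE; apply: (iffP forall_inP) => xS i /xS/eqP. Qed.

Lemma ffun_mulE (x y : gTn) i : (x * y) i = x i * y i.
Proof. by rewrite ffunE. Qed.

Lemma ffun_oneE i : (1 : gTn) i = 1.
Proof. by rewrite ffunE. Qed.

Lemma ffun_invE (x : gTn) i : x^-1 i = (x i)^-1.
Proof. by rewrite ffunE. Qed.

Lemma group_set_trivial_on S : group_set (trivial_on S).
Proof.
apply/group_setP; split=> [|x y /trivial_onP xS /trivial_onP yS].
  by apply/trivial_onP => i _; rewrite ffun_oneE.
by apply/trivial_onP => i iS; rewrite ffun_mulE xS// yS// mulg1.
Qed.
Canonical trivial_on_group S := Group (group_set_trivial_on S).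

Lemma coord_proj_eqP S (x y : gTn) :
  reflect {in S, x =1 y} (coord_proj S x == coord_proj S y).
Proof.
apply: (iffP eqP) => [/ffunP xy i iS|xy]; last first.
  by apply/ffunP => -[i iS]; rewrite !ffunE xy.
by have := xy (exist _ i iS); rewrite !ffunE.
Qed.

Lemma coord_proj_setT_inj : injective (@coord_proj gT n setT).
Proof. by move=> x y /eqP/coord_proj_eqP xy; apply/ffunP => i; apply: xy. Qed.

(** The first isomorphism theorem in counting form: the fibres of [coord_proj S] on [H] are the left
    cosets of [H :&: trivial_on S], and [repr] turns the projection into an injective map on these
    cosets. *)
Lemma card_coord_proj_ker S H :
  (#|coord_proj S @: H| * #|H :&: trivial_on S|)%N = #|H|.
Proof.
pose L := [group of H :&: trivial_on S].
have projV (x y : gTn) :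
    (coord_proj S x == coord_proj S y) = (y \in x *: trivial_on S).
  rewrite mem_lcoset; apply/coord_proj_eqP/trivial_onP => xy i iS.
    by rewrite ffun_mulE ffun_invE xy// mulVg.
  by apply/eqP; rewrite eq_mulVg1 -ffun_invE -ffun_mulE xy.
have reprP x : coord_proj S (repr (x *: L)) = coord_proj S x.
  apply/esym/eqP; rewrite projV.
  have := mem_repr x (lcoset_refl L x).
  by rewrite !mem_lcoset => /setIP[].
suff -> : #|coord_proj S @: H| = #|H : L| by rewrite mulnC Lagrange ?subsetIl.
rewrite -card_lcosets -(@card_in_imset _ _ (fun C => coord_proj S (repr C))).
  rewrite /lcosets -imset_comp; congr #|pred_of_set _|.
  by apply: eq_imset => x; rewrite /= lcosetE reprP.
move=> _ _ /lcosetsP[x Hx ->] /lcosetsP[y Hy ->].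
rewrite !reprP => /eqP; rewrite projV mem_lcoset => xy.
by apply/lcoset_eqP; rewrite lcoset_sym mem_lcoset inE groupM ?groupV.
Qed.

Lemma card_coord_proj_setT S :
  #|coord_proj S @: [set: gTn]| = (#|[set: gT]| ^ #|S|)%N.
Proof.
suff -> : coord_proj S @: [set: gTn] = setT.
  by rewrite cardsT card_ffun card_sig cardsT.
apply/setP => f; rewrite inE; apply/imsetP.
exists [ffun i => if insub i is Some j then f j else 1]; first by rewrite inE.
by apply/ffunP => j; rewrite !ffunE valK.
Qed.

Lemma card_trivial_on S : #|trivial_on S| = (#|[set: gT]| ^ #|~: S|)%N.
Proof.
have := card_coord_proj_ker S [group of [set: gTn]].
rewrite card_coord_proj_setT setTI.
have -> : #|[set: gTn]| = (#|[set: gT]| ^ #|S| * #|[set: gT]| ^ #|~: S|)%N.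
  by rewrite -expnD cardsC card_ord !cardsT card_ffun card_ord.
by move/eqP; rewrite eqn_pmul2l ?expn_gt0 ?cardG_gt0// => /eqP.
Qed.

(** * The coordinatewise pairing and projections of annihilators *)

Definition coord_pairing (B : gT -> gT -> algC) (x y : gTn) : algC :=
  (\prod_i B (x i) (y i))%R.

(** Elements supported at one coordinate read off that coordinate of [y], which reduces
    nondegeneracy on the power to nondegeneracy of [B]. *)
Lemma coord_pairing_dfung1 B i (g : gT) (y : gTn) :
  pairing [set: gT] B ->
  coord_pairing B (dfung1 (gT := fun=> gT) (i := i) g) y = B g (y i).
Proof.
move=> [_ B1 _ _]; rewrite /coord_pairing (bigD1 i)//= dfung1_id.
by rewrite big1 ?mulr1// => j ji; rewrite dfung1_dflt 1?eq_sym// B1.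
Qed.

Lemma pairing_coord B :
  pairing [set: gT] B -> pairing [set: gTn] (coord_pairing B).
Proof.
move=> pB; have [BC B1 BM Bnd] := pB.
split=> [x y _ _|y _|x y z _ _ _|x _ Bx].
- by apply: eq_bigr => i _; apply: BC.
- by apply: big1 => i _; rewrite ffun_oneE B1.
- by rewrite -big_split; apply: eq_bigr => i _; rewrite ffun_mulE BM.
- apply/ffunP => i; rewrite ffun_oneE; apply: Bnd => // g _.
  rewrite BC// -(coord_pairing_dfung1 i g x pB).
  rewrite -[RHS](Bx (dfung1 (gT := fun=> gT) (i := i) g))//.
  by apply: eq_bigr => j _; apply: BC.
Qed.

Lemma annihilator_trivial_on B S : pairing [set: gT] B ->
  annihilator [set: gTn] (coord_pairing B) (trivial_on (~: S)) = trivial_on S.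
Proof.
move=> pB; have [BC B1 BM Bnd] := pB.
apply/setP => y; rewrite inE in_setT /=.
apply/forall_inP/trivial_onP => [By i iS|yS x /trivial_onP xS].
  apply: Bnd => // g _; rewrite BC// -(coord_pairing_dfung1 i g y pB).
  apply/eqP/By/trivial_onP => j; rewrite inE => jS.
  by rewrite dfung1_dflt//; apply: contraNneq jS => <-.
apply/eqP/big1 => i _; have [iS|iS] := boolP (i \in S).
  by rewrite yS// BC// B1.
by rewrite xS ?B1// inE.
Qed.

(** This is the duality formula for ranks with logarithms removed. With [M] the annihilator of [H]
    and [K = trivial_on (~: S)], the kernel [M :&: trivial_on S] of the projection of [M] is the
    annihilator of [H * K], so its order follows from that of [H * K]. *)
Lemma card_coord_proj_annihilator B S H :
  abelian [set: gT] -> pairing [set: gT] B ->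
  (#|coord_proj S @: annihilator [set: gTn] (coord_pairing B) H| * #|H|)%N
  = (#|[set: gT]| ^ #|S| * #|coord_proj (~: S) @: H|)%N.
Proof.
move=> cG pB; have pBn := pairing_coord pB.
have cGn : abelian [set: gTn].
  apply/centsP => x _ y _; apply/ffunP => i.
  by rewrite !ffun_mulE; apply: (centsP cG).
pose K := trivial_on_group (~: S).
pose M := Group (group_set_annihilator pBn (subsetT H)).
have HKE : H <*> K = H * K.
  by rewrite norm_joinEr// cents_norm// (sub_abelian_cent2 cGn) ?subsetT.
have cardM : (#|H| * #|M|)%N = #|[set: gTn]|.
  by apply: (card_annihilator pBn); apply: subsetT.
have cardMS : (#|(H * K)%g| * #|M :&: trivial_on S|)%N = #|[set: gTn]|.
  rewrite -(card_annihilator pBn (subsetT (H <*> K)%G)) /= HKE.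
  rewrite (annihilatorM pBn) ?subsetT//.
  by rewrite (annihilator_trivial_on S pB).
have projM := card_coord_proj_ker S M.
have projH := card_coord_proj_ker (~: S) H.
have cardHK := mul_cardG H K.
have cardK : #|K| = (#|[set: gT]| ^ #|S|)%N.
  by rewrite /K /= card_trivial_on setCK.
have HK0 : (0 < #|H :&: K|)%N by apply: cardG_gt0.
have M0 : (0 < #|M :&: trivial_on_group S|)%N by apply: cardG_gt0.
(* [H :&: K] is the kernel of the projection of [H] to [~: S], so the product formula for [#|H * K|]
   leaves [#|K|] times the size of that projection. *)
have HKcard : #|(H * K)%g| = (#|[set: gT]| ^ #|S| * #|coord_proj (~: S) @: H|)%N.
  apply/eqP; rewrite -(eqn_pmul2r HK0) -cardHK -mulnA projH cardK.
  by rewrite mulnC.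
by apply/eqP; rewrite -(eqn_pmul2r M0) -HKcard cardMS mulnAC projM mulnC cardM.
Qed.

End Projections.

(** * Duality *)

Lemma ln_natM (R : realType) (a b : nat) : (0 < a)%N -> (0 < b)%N ->
  (ln (a * b)%:R = ln a%:R + ln b%:R :> R)%R.
Proof. by move=> a0 b0; rewrite natrM lnM// posrE ltr0n. Qed.

Section Duality.

Variables (R : realType) (gT : finGroupType) (n : nat).
Hypothesis gT_gt1 : (1 < #|[set: gT]|)%N.
Local Notation gTn := {dffun forall _ : 'I_n, gT}.

Lemma card_coord_proj_gt0 (S : {set 'I_n}) (H : {group gTn}) :
  (0 < #|coord_proj S @: H|)%N.
Proof.
by apply/card_gt0P; exists (coord_proj S 1); apply: imset_f; apply: group1.
Qed.

Lemma dual_polymatroidP (H H' : {group gTn}) :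
  dual_polymatroid (group_polymatroid R H) = group_polymatroid R H' <->
  forall S : {set 'I_n}, (#|coord_proj S @: H'| * #|H|)%N
    = (#|[set: gT]| ^ #|S| * #|coord_proj (~: S) @: H|)%N.
Proof.
have lnG : (ln #|[set: gT]|%:R : R) != 0%R.
  by rewrite gt_eqF// ln_gt0// ltr1n.
suff rankE (S : {set 'I_n}) :
  dual_polymatroid (group_polymatroid R H) S = group_polymatroid R H' S <->
  (#|coord_proj S @: H'| * #|H|)%N
    = (#|[set: gT]| ^ #|S| * #|coord_proj (~: S) @: H|)%N.
  by split=> [/ffunP E S|E]; [apply/rankE|apply/ffunP => S; apply/rankE].
have G0 : (0 < #|[set: gT]| ^ #|S|)%N by rewrite expn_gt0 cardG_gt0.
have lnE : (ln (#|[set: gT]| ^ #|S|)%:R = ln #|[set: gT]|%:R * #|S|%:R :> R)%R.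
  by rewrite natrX lnXn ?ltr0n ?cardG_gt0// mulr_natr.
(* Projecting to all coordinates is injective, so the rank of the full ground set is the logarithm
   of [#|H|]. *)
rewrite !ffunE /logb (card_imset _ (@coord_proj_setT_inj gT n)).
have -> (a b c d : nat) : (0 < a)%N -> (0 < b)%N -> (0 < c)%N -> (0 < d)%N ->
  (a * b = c * d)%N <-> (ln a%:R + ln b%:R = ln c%:R + ln d%:R :> R)%R.
  move=> a0 b0 c0 d0; rewrite -!ln_natM//; split=> [->//|].
  move/ln_inj; rewrite !posrE !ltr0n !muln_gt0 a0 b0 c0 d0.
  by move=> /(_ isT isT)/eqP; rewrite eqr_nat => /eqP.
all: rewrite ?card_coord_proj_gt0 ?cardG_gt0//.
(* Writing [#|S|] as a quotient by the logarithm of the group order puts all terms over one nonzero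
   denominator. *)
rewrite lnE -[X in (_ + X - _)%R](mulfK lnG) -mulrDl -mulrBl.
split=> [/(mulIf _) E|E].
  by rewrite -E ?invr_eq0// [(_ * #|S|%:R)%R]mulrC subrK addrC.
by congr (_ / _)%R; apply/eqP; rewrite subr_eq E mulrC addrC.
Qed.

End Duality.

(** * The two implications *)

Lemma abelian_closed (R : realType) (gT : finGroupType) :
  (1 < #|[set: gT]|)%N -> abelian [set: gT] ->
  closed_under_polymatroid_duality R gT.
Proof.
move=> gT_gt1 cG n _ H; have [B pB] := abelian_pairing cG.
exists (Group (group_set_annihilator (pairing_coord n pB) (subsetT H))).
by apply/dual_polymatroidP => // S; apply: card_coord_proj_annihilator.
Qed.

Lemma closed_abelian (R : realType) (gT : finGroupType) :
  (1 < #|[set: gT]|)%N -> closed_under_polymatroid_duality R gT ->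
  abelian [set: gT].
Proof.
move=> gT_gt1 closedG; set b := #|[set: gT]| in gT_gt1.
pose gT3 := {dffun forall _ : 'I_3, gT}.
pose diag (g : gT) : gT3 := [ffun=> g].
have diag_set : group_set [set diag g | g in [set: gT]].
  apply/group_setP; split=> [|_ _ /imsetP[g _ ->] /imsetP[h _ ->]].
    by apply/imsetP; exists 1 => //; apply/ffunP => i; rewrite !ffunE.
  by apply/imsetP; exists (g * h) => //; apply/ffunP => i; rewrite !ffunE.
have [H' /dual_polymatroidP -/(_ gT_gt1) dualE] := closedG 3 isT (Group diag_set).
have card_diag_proj (S : {set 'I_3}) i : i \in S ->
    #|coord_proj S @: [set diag g | g in [set: gT]]| = b.
  move=> iS; rewrite -imset_comp card_imset// => g h /eqP.
  by move=> /coord_proj_eqP/(_ i iS); rewrite !ffunE.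
have b_gt0 : (0 < b)%N by apply: ltnW.
have card_diag : #|[set diag g | g in [set: gT]]| = b.
  by rewrite -(card_imset _ (@coord_proj_setT_inj gT 3)) (card_diag_proj _ ord0).
(* The complement of [[set i; j]] contains [k], so the diagonal projects there with [b] elements,
   which cancels the factor [b] from its order. *)
have card_pair (i j k : 'I_3) : i != j -> i != k -> j != k ->
    #|coord_proj [set i; j] @: H'| = (b ^ 2)%N.
  move=> ij ik jk; apply/eqP; rewrite -(eqn_pmul2r b_gt0).
  have := dualE [set i; j]; rewrite /= card_diag (card_diag_proj _ k) ?cards2 ?ij.
    by move=> ->.
  by rewrite !inE negb_or ![k == _]eq_sym ik jk.
(* For the full set the complement is empty and the projection is a point, whence
   [#|H'| * b = b ^ 3]. *)
have cardH' : #|H'| = (b ^ 2)%N.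
  have := dualE setT; rewrite /= card_diag (cardsT 'I_3) card_ord setCT.
  rewrite (card_imset _ (@coord_proj_setT_inj gT 3)).
  have -> : #|coord_proj set0 @: [set diag g | g in [set: gT]]| = 1%N.
    apply/eqP; rewrite eqn_leq (card_coord_proj_gt0 _ (Group diag_set)) andbT.
    apply/card_le1_eqP => p q _ _; apply/ffunP => -[i i0].
    by exfalso; rewrite inE in i0.
  by rewrite muln1 expnSr => /eqP; rewrite eqn_pmul2r// => /eqP.
have pair_onto (i j k : 'I_3) (g h : gT) : i != j -> i != k -> j != k ->
    exists2 u : gT3, u \in H' & u i = g /\ u j = h.
  move=> ij ik jk; pose f : gT3 := [ffun l => if l == i then g else h].
  have projE : coord_proj [set i; j] @: H' = coord_proj [set i; j] @: setT.
    apply/eqP; rewrite eqEcard imsetS ?subsetT//=.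
    by rewrite card_coord_proj_setT cards2 ij (card_pair i j k).
  have := imset_f (coord_proj [set i; j]) (in_setT f); rewrite -projE.
  move=> /imsetP[u uH' /esym/eqP/coord_proj_eqP uf].
  exists u => //; rewrite !uf ?inE ?eqxx ?orbT// !ffunE eqxx.
  by rewrite eq_sym (negPf ij).
pose i0 : 'I_3 := inord 0; pose i1 : 'I_3 := inord 1; pose i2 : 'I_3 := inord 2.
have [n01 n02 n12] : [/\ i0 != i1, i0 != i2 & i1 != i2].
  by rewrite -!val_eqE /= !inordK.
apply/centsP => x _ y _; apply/commgP/eqP.
have [u uH' [u0 u2]] : exists2 u : gT3, u \in H' & u i0 = 1 /\ u i2 = x.
  by apply: (pair_onto i0 i2 i1); rewrite // eq_sym.
have [v vH' [v1 v2]] : exists2 v : gT3, v \in H' & v i1 = 1 /\ v i2 = y.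
  by apply: (pair_onto i1 i2 i0); rewrite // eq_sym.
have commE i : [~ u, v] i = [~ u i, v i].
  by rewrite /commg /conjg !ffun_mulE !ffun_invE.
(* Both sides are [b ^ 2], so an element of [H'] is determined by its coordinates [i0] and [i1]. The
   commutator of [u] and [v] is trivial at [i0] because [u] is, and at [i1] because [v] is. *)
have /imset_injP inj01 : #|coord_proj [set i0; i1] @: H'| == #|H'|.
  by rewrite (card_pair i0 i1 i2)// cardH'.
rewrite -u2 -v2 -commE (inj01 [~ u, v] 1) ?group1 ?groupR ?ffun_oneE//.
apply/eqP/coord_proj_eqP => i; rewrite !inE commE ffun_oneE.
by case/orP => /eqP->; rewrite ?u0 ?v1 ?comm1g ?commg1.
Qed.

Theorem theorem9p22 (R : realType) (gT : finGroupType)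
    (gT_nontrivial : (1 < #|[set: gT]|)%N) :
  closed_under_polymatroid_duality R gT <-> abelian [set: gT].
Proof. by split; [apply: closed_abelian | apply: abelian_closed]. Qed.
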